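(* Let $D$ be a normalized set in a Banach space $X$. (1) Suppose $D$ is a $(c,q)$-quick representing system in $X$, where $c>0$ and $q\in(0,1)$. Then for every $\varepsilon>0$ there is a positive integer $m=m(c,q,\varepsilon)$, depending only on $c,q,\varepsilon$, such that with $b=c(1-q)^{-1}$ the set $$b\cdot\bigcup\{\mathrm{a.conv}(D_1): D_1\subset D,\ |D_1|\le m\}$$ is an $\varepsilon$-net of $B(X)$. (2) Conversely, if $0<\varepsilon<1$, $b>0$, $m$ is a positive integer, and the set displayed above is an $\varepsilon$-net of $B(X)$, then $D$ is a $(c,q)$-quick representing system in $X$ with $c=b/\varepsilon$ and $q=\varepsilon^{1/m}$.
   Context: Banach spaces are real and nonzero; $B(X)$ is the closed unit ball of $X$. A set is normalized if all its elements have norm $1$. $\mathrm{a.conv}(D_1)$ denotes the absolutely convex hull of $D_1$, i.e. the set of all finite sums $\sum a_i x_i$ with $x_i\in D_1$ and $\sum|a_i|\le1$. For $c>0$ and $q\in(0,1)$, a set $D\subset X$ is a $(c,q)$-quick representing system in $X$ if every $x\in X$ can be written as $x=\sum_{i=1}^\infty a_i x_i$ with scalars $a_i$, elements $x_i\in D$ (repetitions allowed), and $\|a_i x_i\|\le c q^{i-1}\|x\|$ for all $i\ge1$. A set $A\subset X$ is an $\varepsilon$-net of a set $K\subset X$ if for every $x\in K$ there is $y\in A$ with $\|x-y\|\le\varepsilon$ ($A$ need not be contained in $K$). *)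

(* Defs.v *)
From HB Require Import structures.
From mathcomp Require Import all_boot all_order all_algebra.
From mathcomp Require Import all_classical all_reals all_analysis.
Set Implicit Arguments.
Unset Strict Implicit.
Unset Printing Implicit Defensive.
Import Order.TTheory GRing.Theory Num.Theory.
Import numFieldNormedType.Exports.
Local Open Scope classical_set_scope.
Local Open Scope ring_scope.

Definition unit_ball (R : realType) (X : normedModType R) : set X :=
  [set x | `|x| <= 1].
Arguments unit_ball {R} X.

Definition normalized (R : realType) (X : normedModType R) (D : set X) : Prop :=
  forall x, D x -> `|x| = 1.

(* n = 0 is allowed: the hull always contains the empty sum 0, and the hull
   of the empty set is {0}. *)
Definition aconv (R : realType) (X : normedModType R) (D : set X) : set X :=
  [set y | exists (n : nat) (a : 'I_n -> R) (x : 'I_n -> X),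
     [/\ forall i, D (x i), \sum_(i < n) `|a i| <= 1
       & y = \sum_(i < n) a i *: x i]].

Definition scaled_aconvs (R : realType) (X : normedModType R)
    (b : R) (m : nat) (D : set X) : set X :=
  [set b *: y | y in
    \bigcup_(D1 in [set D1 : set X | D1 `<=` D /\ (D1 #<= `I_m)%card]) aconv D1].

Definition is_net (R : realType) (X : normedModType R)
    (eps : R) (A K : set X) : Prop :=
  forall x, K x -> exists2 y, A y & `|x - y| <= eps.

(* Terms are indexed from 0, so the exponent i - 1 becomes i. *)
Definition quick_representing (R : realType) (X : normedModType R)
    (c q : R) (D : set X) : Prop :=
  [/\ 0 < c, 0 < q < 1 &
    forall x : X, exists (a : nat -> R) (u : nat -> X),
      [/\ forall i, D (u i),
          series (fun i => a i *: u i) @ \oo --> x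
        & forall i, `|a i *: u i| <= c * q ^+ i * `|x| ]].

(* Main.v *)
Require Import Defs.
From HB Require Import structures.
From mathcomp Require Import all_boot all_order all_algebra.
From mathcomp Require Import all_classical all_reals all_analysis.
Set Implicit Arguments.
Unset Strict Implicit.
Unset Printing Implicit Defensive.
Import Order.TTheory GRing.Theory Num.Theory.
Import numFieldNormedType.Exports.
Local Open Scope classical_set_scope.
Local Open Scope ring_scope.

(** For (1), cut a quick representation of a point of the unit ball after [m] terms. As [D] is
    normalized, the coefficients are at most [c * q ^+ i] in absolute value, hence sum to at most
    [c / (1 - q)], and the tail is at most [c * q ^+ m / (1 - q)]. This bound tends to 0 and
    involves neither [X] nor [D], so [m] is uniform ([quick_representing_net]). For (2), homogeneity
    turns the net into an [m]-term approximation of every [x] with relative error [eps] and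
    coefficients at most [b * |x|] ([net_approximation]). Iterating on the remainders gives blocks
    of [m] terms, the [k]-th of size [b * eps ^+ k * |x|]; with [q ^+ m = eps] this is geometric
    decay of ratio [q] per term, up to the factor [1 / eps] lost within a block
    ([blockwise_expansion]). *)

Lemma geometric_sum_le (R : realFieldType) (q : R) (n N : nat) :
  0 < q < 1 -> (n <= N)%N -> \sum_(n <= k < N) q ^+ k <= q ^+ n / (1 - q).
Proof.
move=> /andP[q0 q1] nN; have q'0 : 0 < 1 - q by rewrite subr_gt0.
rewrite ler_pdivlMr// mulr_suml.
rewrite (eq_bigr (fun k => - (q ^+ k.+1 - q ^+ k))); last first.
  by move=> k _; rewrite mulrBr mulr1 -exprSr opprB.
by rewrite sumrN telescope_sumr// opprB gerBl exprn_ge0// ltW.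
Qed.

(** A late enough partial sum is within any [e] of [x], and its distance to the [n]-th one is
    bounded by a geometric sum. *)
Lemma series_remainder_le (R : realType) (X : normedModType R)
    (f : nat -> X) (x : X) (C q : R) (n : nat) :
  0 < q < 1 -> 0 <= C -> (forall i, `|f i| <= C * q ^+ i) ->
  series f @ \oo --> x -> `|x - series f n| <= C * (q ^+ n / (1 - q)).
Proof.
move=> q01 C0 fC /cvgrPdist_le fx; apply/ler_addgt0Pr => e e0.
have [N _ xN] := fx e e0.
have nM : (n <= maxn n N)%N by rewrite leq_maxl.
rewrite -(subrKA (series f (maxn n N))) addrC (le_trans (ler_normD _ _))//.
apply: lerD; last by apply: xN => /=; rewrite leq_maxr.
rewrite sub_series_geq// (le_trans (ler_norm_sum _ _ _))//.
rewrite (le_trans (ler_sum _ (fun i _ => fC i)))// -mulr_sumr.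
by rewrite ler_wpM2l// geometric_sum_le.
Qed.

Lemma quick_representing_net (R : realType) (c q eps : R) (m : nat)
    (X : normedModType R) (D : set X) :
  c * (q ^+ m / (1 - q)) <= eps -> normalized D -> quick_representing c q D ->
  is_net eps (scaled_aconvs (c * (1 - q)^-1) m D) (unit_ball X).
Proof.
move=> meps D1 [c0 q01 Drep] x /= x1; have [a [u [Du aux au]]] := Drep x.
have q'0 : 0 < 1 - q by rewrite subr_gt0; case/andP: q01.
have b0 : 0 < c * (1 - q)^-1 by rewrite divr_gt0.
have auq i : `|a i *: u i| <= c * q ^+ i.
  rewrite (le_trans (au i))// ler_piMr// mulr_ge0 ?exprn_ge0// ltW//.
  by case/andP: q01.
exists (series (fun i => a i *: u i) m); last first.
  exact: le_trans (series_remainder_le m q01 (ltW c0) auq aux) meps.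
exists ((c * (1 - q)^-1)^-1 *: series (fun i => a i *: u i) m); last first.
  by rewrite scalerA divff ?gt_eqF// scale1r.
(* The [u i] may repeat, so this set has at most [m] elements. *)
exists (u @` `I_m); first by split; [move=> _ [i _ <-]|exact: card_image_le].
exists m, (fun i => (c * (1 - q)^-1)^-1 * a i), (fun i => u i); split.
- by move=> i; exists i => /=.
- under eq_bigr do rewrite normrM gtr0_norm ?invr_gt0//.
  rewrite -mulr_sumr mulrC ler_pdivrMr// mul1r.
  rewrite -(big_mkord xpredT (fun i => `|a i|)).
  apply: (@le_trans _ _ (\sum_(0 <= i < m) c * q ^+ i)).
    by apply: ler_sum => i _; rewrite -(mulr1 `|a i|) -(D1 _ (Du i)) -normrZ.
  by rewrite -mulr_sumr ler_pM2l// (le_trans (geometric_sum_le _ _))// mul1r.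
- rewrite /series /= big_mkord scaler_sumr.
  by apply: eq_bigr => i _; rewrite scalerA.
Qed.

(* Repeated elements are merged into one term, unused terms are padded with
   [d] and coefficient [0]. *)
Lemma aconv_card (R : realType) (X : normedModType R) (D1 : set X) (m : nat)
    (d y : X) : (D1 #<= `I_m)%card -> aconv D1 y ->
  exists (a : nat -> R) (u : nat -> X),
    [/\ forall i, D1 (u i) \/ u i = d, forall i, `|a i| <= 1
      & y = \sum_(i < m) a i *: u i].
Proof.
move=> /pcard_leP[f] [n [a [x [Dx a1 ->]]]].
have fm i : (f (x i) < m)%N by exact: (@funS _ _ _ _ f _ (Dx i)).
have finj i j : f (x i) = f (x j) -> x i = x j.
  by move=> fij; apply: (@inj _ _ _ f) => //; rewrite inE.
(* The injection [f] numbers the elements of [D1] below [m]; terms are merged by number. *)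
exists (fun j => \sum_(i < n | f (x i) == j) a i).
exists (fun j => if [pick i | f (x i) == j] is Some i then x i else d).
split=> [j|j|].
- by case: pickP => [i _|_]; [left|right].
- rewrite (le_trans (ler_norm_sum _ _ _))// (le_trans _ a1)//.
  by rewrite [leRHS](bigID (fun i => f (x i) == j))/= lerDl sumr_ge0.
- rewrite (partition_big (fun i => Ordinal (fm i)) xpredT)//=.
  apply: eq_bigr => j _; rewrite scaler_suml; apply: eq_big => // i.
  move=> /eqP fij; case: pickP => [k /eqP fk|/(_ i)].
    by rewrite (finj k i)// fk -fij.
  by rewrite -fij eqxx.
Qed.

(** Normalize [x], apply the net, and scale back; [x = 0] is treated apart. The bound on the sum of
    the coefficients is only kept for each one separately. *)
Lemma net_approximation (R : realType) (X : normedModType R) (D : set X)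
    (eps b : R) (m : nat) (d : X) : 0 < b -> D d ->
  is_net eps (scaled_aconvs b m D) (unit_ball X) ->
  forall x : X, exists (a : nat -> R) (u : nat -> X),
    [/\ forall i, D (u i), forall i, `|a i| <= b * `|x|
      & `|x - \sum_(i < m) a i *: u i| <= eps * `|x|].
Proof.
move=> b0 Dd net x; have [->|x0] := eqVneq x 0.
  exists (fun=> 0), (fun=> d); split => // [i|]; rewrite ?normr0 ?mulr0//.
  by rewrite big1 ?subrr ?normr0// => i _; rewrite scale0r.
have nx0 : 0 < `|x| by rewrite normr_gt0.
have /net[_ [y [D1 [D1D D1m] D1y] <-] xy] : unit_ball X (`|x|^-1 *: x).
  by rewrite /unit_ball/= normrZ normfV normr_id mulVf ?gt_eqF.
have [a [u [Du a1 yE]]] := aconv_card d D1m D1y.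
exists (fun i => b * `|x| * a i), u; split => [i|i|].
- by have [/D1D|->] := Du i.
- by rewrite normrM gtr0_norm ?mulr_gt0// ler_piMr// mulr_ge0// ltW.
- rewrite (_ : x - _ = `|x| *: (`|x|^-1 *: x - b *: y)).
    by rewrite normrZ normr_id mulrC ler_pM2r.
  rewrite scalerBr !scalerA divff ?gt_eqF// scale1r yE scaler_sumr.
  by congr (_ - _); apply: eq_bigr => i _; rewrite scalerA (mulrC b).
Qed.

(* Greedy expansion: apply the approximation to [x], then to the remainder, and
   so on, each step contributing a block of [m] terms and shrinking the
   remainder by [q ^+ m]. *)
Lemma blockwise_expansion (R : realType) (X : normedModType R) (D : set X)
    (q b : R) (m : nat) :
  0 < q < 1 -> 0 < b -> (0 < m)%N -> normalized D ->
  (forall x : X, exists (a : nat -> R) (u : nat -> X),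
    [/\ forall i, D (u i), forall i, `|a i| <= b * `|x|
      & `|x - \sum_(i < m) a i *: u i| <= q ^+ m * `|x|]) ->
  quick_representing (b / q ^+ m) q D.
Proof.
move=> q01 b0 m0 D1 happrox; have /andP[q0 q1] := q01.
have qm0 : 0 < q ^+ m by rewrite exprn_gt0.
have [A /choice[U AU]] := choice happrox.
split=> //; first by rewrite divr_gt0.
(* [r k] is what remains of [x] after [k] blocks. *)
move=> x; pose r k := iter k (fun y => y - \sum_(i < m) A y i *: U y i) x.
have rq k : `|r k| <= q ^+ (m * k) * `|x|.
  elim: k => [|k IH]; first by rewrite muln0 mul1r.
  have [_ _ /le_trans->//] := AU (r k).
  by rewrite mulnS exprD -mulrA ler_pM2l.
pose f i := A (r (i %/ m)%N) (i %% m)%N *: U (r (i %/ m)%N) (i %% m)%N.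
(* Rounding [i] down to a multiple of [m] loses less than [m]: this is where the constant
   [b / q ^+ m] comes from. *)
have expo i : q ^+ (m * (i %/ m)) <= (q ^+ m)^-1 * q ^+ i.
  rewrite mulrC ler_pdivlMr// -exprD ler_wiXn2l ?(ltW q0) ?(ltW q1)//.
  by rewrite addnC -mulnS mulnC ltnW// ltn_ceil.
have fq i : `|f i| <= b / q ^+ m * q ^+ i * `|x|.
  have [DU Ab _] := AU (r (i %/ m)%N).
  rewrite normrZ (D1 _ (DU _)) mulr1 (le_trans (Ab _))// -!mulrA ler_pM2l//.
  by rewrite (le_trans (rq _))// mulrA ler_wpM2r.
have block k l : (l <= m)%N -> series f (k * m + l)%N =
    series f (k * m)%N + \sum_(i < l) A (r k) i *: U (r k) i.
  elim: l => [|l IH] lm; first by rewrite addn0 big_ord0 addr0.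
  rewrite addnS seriesSr IH 1?ltnW// big_ord_recr /= addrA /f.
  by rewrite divnMDl// divn_small// addn0 modnMDl modn_small.
have serE k : series f (k * m)%N = x - r k.
  elim: k => [|k IH]; first by rewrite /series /= big_geq// subrr.
  by rewrite mulSn addnC block// IH /= opprB addrA addrAC.
(* A partial sum ending inside block [k] misses [x] by at most the norm of [r k] plus that of at
   most [m] terms, each bounded by [b * |r k|]. *)
pose C := (1 + m%:R * b) * ((q ^+ m)^-1 * `|x|).
have C0 : 0 <= C.
  by rewrite !mulr_ge0 ?invr_ge0 ?addr_ge0 ?mulr_ge0// ltW.
have remq n : `|x - series f n| <= C * q ^+ n.
  have [_ Ab _] := AU (r (n %/ m)%N).
  have lm : (n %% m <= m)%N by rewrite ltnW// ltn_mod.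
  rewrite [in series f n](divn_eq n m) (block _ _ lm) serE opprD addrA subKr.
  apply: (@le_trans _ _ ((1 + m%:R * b) * `|r (n %/ m)%N|)).
    rewrite (le_trans (ler_normB _ _))// mulrDl mul1r lerD2l.
    rewrite (le_trans (ler_norm_sum _ _ _))//.
    apply: (@le_trans _ _ (\sum_(i < n %% m) b * `|r (n %/ m)%N|)).
      apply: ler_sum => i _; have [DU _ _] := AU (r (n %/ m)%N).
      by rewrite normrZ (D1 _ (DU _)) mulr1.
    rewrite sumr_const card_ord -[leLHS]mulr_natl mulrA ler_wpM2r// ler_wpM2r//.
      exact: ltW.
    by rewrite ler_nat ltnW// ltn_mod.
  rewrite -!mulrA ler_wpM2l ?addr_ge0 ?mulr_ge0// ?(ltW b0)//.
  by rewrite (le_trans (rq _))// (mulrC `|x|) mulrA ler_wpM2r.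
exists (fun i => A (r (i %/ m)%N) (i %% m)%N),
  (fun i => U (r (i %/ m)%N) (i %% m)%N); split => //.
  by move=> i; have [DU _ _] := AU (r (i %/ m)%N).
apply/cvgrPdist_le => e e0.
have /cvgrPdist_le/(_ e e0) : C * q ^+ n @[n --> \oo] --> (0 : R).
  by apply: cvg_geometric; rewrite gtr0_norm.
apply: filterS => n; rewrite sub0r normrN; apply: le_trans.
by rewrite (le_trans (remq n))// ler_norm.
Qed.

Theorem theorem2p4 (R : realType) :
  (forall c q eps : R, 0 < c -> 0 < q < 1 -> 0 < eps ->
    exists m : nat, (0 < m)%N /\
      forall (X : completeNormedModType R) (D : set X),
        (exists x : X, x != 0) -> normalized D ->
        quick_representing c q D ->
        is_net eps (scaled_aconvs (c * (1 - q)^-1) m D) (unit_ball X))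
  /\
  (forall (X : completeNormedModType R) (D : set X),
    (exists x : X, x != 0) -> normalized D ->
    forall (eps b : R) (m : nat), 0 < eps < 1 -> 0 < b -> (0 < m)%N ->
      is_net eps (scaled_aconvs b m D) (unit_ball X) ->
      quick_representing (b / eps) (eps `^ (m%:R^-1)) D).
Proof.
split=> [c q eps c0 q01 eps0|X D [x x0] D1 eps b m eps01 b0 m0 net].
  have /andP[q0 q1] := q01.
  have /cvgrPdist_le/(_ eps eps0)[m _ qm] :
      c / (1 - q) * q ^+ n @[n --> \oo] --> (0 : R).
    by apply: cvg_geometric; rewrite gtr0_norm.
  exists m.+1; split=> // X D _; apply: quick_representing_net.
  have := qm m.+1 (leqnSn m); rewrite /= sub0r normrN mulrAC mulrA.
  by apply: le_trans; rewrite ler_norm.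
have /andP[eps0 eps1] := eps01; pose q := eps `^ m%:R^-1.
have qmE : q ^+ m = eps.
  rewrite -powR_mulrn ?powR_ge0// -powRrM mulVf ?pnatr_eq0 -?lt0n//.
  by rewrite powRr1// ltW.
have q0 : 0 < q by rewrite powR_gt0.
have q1 : q < 1 by rewrite -(@expr_lt1 _ m) ?powR_ge0// qmE.
(* If [D] were empty, the net would be reduced to 0, which is at distance [1 > eps] from a unit
   vector; such a vector exists as [X] is nonzero. *)
have [d Dd] : exists d, D d.
  apply: contrapT => /forallNP nD.
  have /net[_ [_ [D' [D'D _] [n [a [u [Du _ ->]]]]] <-]] :
      unit_ball X (`|x|^-1 *: x).
    by rewrite /unit_ball/= normrZ normfV normr_id mulVf ?normr_eq0.
  rewrite big1 => [|i _]; last by case: (nD (u i)); apply/D'D.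
  rewrite scaler0 subr0 normrZ normfV normr_id mulVf ?normr_eq0//.
  by rewrite leNgt eps1.
rewrite -/q -{1}qmE; apply: blockwise_expansion => //; first by rewrite q0.
by rewrite qmE; exact: net_approximation Dd net.
Qed.
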